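(* Let $k$ be an integer with $1\le k\le N-1$ such that $\phi^{k-1}-\phi^k>\phi^k-\phi^{k+1}$, and let ${\tt X}\in\aleph_k^\circ$ be an unlabeled atom of $\mathfrak{A}_k$. Then $\tilde{\cal F}^{k-1}|_{\uparrow{\tt X}}\subseteq\tilde{\cal T}^\circ_{\tt X}$, i.e. $F|_{\uparrow{\tt X}}\in\tilde{\cal T}^\circ_{\tt X}$ for every $F\in\tilde{\cal F}^{k-1}$.
   Context: $V$ is a directed graph without loops on a finite vertex set ${\tt N}$, $|{\tt N}|=N$; each arc $(i,j)$ has a real weight $v_{ij}$; $V$ is assumed to have at least one spanning tree. An (entering) forest is a directed graph in which at most one arc leaves each vertex and there are no directed cycles; its components are trees, the root of a tree being its unique vertex with no outgoing arc. All forests and trees are subgraphs of $V$. For a subgraph $G$ and ${\tt D}\subseteq{\tt N}$, $\Upsilon^G_{\tt D}=\sum_{i\in{\tt D},(i,j)\in G}v_{ij}$ (heads may lie outside ${\tt D}$), $\Upsilon^G=\Upsilon^G_{\tt N}$. ${\cal F}^j$: spanning forests of $V$ with exactly $j$ trees; $\phi^j=\min_{F\in{\cal F}^j}\Upsilon^F$ ($\phi^j=\infty$ if ${\cal F}^j=\emptyset$; $\phi^0=\infty$); $\tilde{\cal F}^j$: forests in ${\cal F}^j$ of weight $\phi^j$. $\mathfrak{A}_k$: algebra of subsets of ${\tt N}$ generated by the vertex sets of all trees of all forests in $\tilde{\cal F}^k$; $\aleph_k$: its atoms (nonempty elements ${\tt A}$ with ${\tt A}\cap{\tt B}\in\{\emptyset,{\tt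 A}\}$ for all ${\tt B}\in\mathfrak{A}_k$); $\aleph_k^\bullet$: labeled atoms (containing a root of some tree of some $F\in\tilde{\cal F}^k$); $\aleph_k^\circ=\aleph_k\setminus\aleph_k^\bullet$. For ${\tt D}\subseteq{\tt N}$: ${\cal T}^\bullet_{\tt D}$ is the set of trees with vertex set ${\tt D}$; ${\cal T}^\circ_{\tt D}$ is the set of trees $T$ with $|{\tt V}T|=|{\tt D}|+1$, ${\tt D}\subset{\tt V}T$, and $T|_{\tt D}\in{\cal T}^\bullet_{\tt D}$; $\lambda^\circ_{\tt D}=\min_{T\in{\cal T}^\circ_{\tt D}}\Upsilon^T$ and $\tilde{\cal T}^\circ_{\tt D}=\{T\in{\cal T}^\circ_{\tt D}:\Upsilon^T=\lambda^\circ_{\tt D}\}$. $G|_{\tt D}$ is the induced subgraph on ${\tt D}$. ${\tt N}^{out}_{\tt D}(G)$ is the set of heads $j\notin{\tt D}$ of arcs $(i,j)\in G$ with $i\in{\tt D}$. The outgoing restriction $G|_{\uparrow{\tt D}}$ has as arcs exactly the arcs of $G$ with tail in ${\tt D}$ and vertex set ${\tt D}\cup{\tt N}^{out}_{\tt D}(G)$. For a set ${\cal F}$ of graphs, ${\cal F}|_{\uparrow{\tt D}}=\{F|_{\uparrow{\tt D}}:F\in{\cal F}\}$.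
   Formalization: The set T°_D is taken to consist only of those trees whose root is the additional vertex outside D; without this condition a tree with an arc entering D from the additional vertex would also qualify, and the claim would be false. *)

(* Defs.v *)
From HB Require Import structures.
From mathcomp Require Import all_boot all_order all_algebra.
From mathcomp Require Import constructive_ereal.

Set Implicit Arguments.
Unset Strict Implicit.
Unset Printing Implicit Defensive.

Import Order.TTheory GRing.Theory Num.Theory.
Local Open Scope ring_scope.

Section Digraphs.
Variable T : finType.

(* A pair (vertex set, arc set); the arc (i, j) leaves its tail i and enters
   its head j.  Well-formedness (arcs join vertices) is not built into the
   type: it is required by [subgraph]. *)
Definition digraph := ({set T} * {set T * T})%type.

Implicit Types (G H V F t : digraph) (D : {set T}) (r : T).

Definition verts G : {set T} := G.1.
Definition arcs G : {set T * T} := G.2.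

Definition wf_digraph G : bool :=
  [forall a in arcs G, (a.1 \in verts G) && (a.2 \in verts G)].

Definition loopless G : bool := [forall i, (i, i) \notin arcs G].

Definition subgraph H G : bool :=
  [&& wf_digraph H, verts H \subset verts G & arcs H \subset arcs G].

Definition arc_rel G : rel T := [rel i j | (i, j) \in arcs G].
Definition adj_rel G : rel T := [rel i j | arc_rel G i j || arc_rel G j i].

(* No arc closes a directed path into a directed cycle; see [acyclicP]. *)
Definition acyclic G : bool :=
  [forall i, forall j, arc_rel G i j ==> ~~ connect (arc_rel G) j i].

Lemma acyclicP G :
  reflect (forall c : seq T, cycle (arc_rel G) c -> c = [::]) (acyclic G).
Proof.
apply: (iffP idP) => [acG [//|x p] | noC].
  rewrite /= rcons_path => /andP[xp lx].
  move/forallP/(_ (last x p))/forallP/(_ x)/implyP/(_ lx): acG => /negP[].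
  by apply/connectP; exists p.
apply/forallP=> i; apply/forallP=> j; apply/implyP=> ij; apply/negP.
case/connectP=> p jp ei.
by have := noC (j :: p); rewrite /= rcons_path jp -ei ij => /(_ isT).
Qed.

Definition out_at_most_one G : bool :=
  [forall i, #|[set j | (i, j) \in arcs G]| <= 1]%N.

(* Entering forests among the subgraphs of V. *)
Definition is_forest V F : bool :=
  [&& subgraph F V, out_at_most_one F & acyclic F].

Definition induced G D : digraph :=
  (verts G :&: D, [set a in arcs G | (a.1 \in D) && (a.2 \in D)]).

(* Vertex sets of the weakly connected components. *)
Definition comp_verts G : {set {set T}} :=
  [set [set j in verts G | connect (adj_rel G) i j] | i in verts G].

Definition components G : {set digraph} :=
  [set induced G C | C in comp_verts G].

Definition is_tree V t : bool := is_forest V t && (#|components t| == 1%N).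

Definition is_root t r : bool :=
  (r \in verts t) && [forall j, (r, j) \notin arcs t].

Definition spanning V G : bool := verts G == verts V.

(* Empty for j = 0 (unless V has no vertices), so that phi 0 = +oo below. *)
Definition spanning_forests V (j : nat) : {set digraph} :=
  [set F | [&& is_forest V F, spanning V F & #|components F| == j]].

Definition out_nbrs G D : {set T} :=
  [set j | (j \notin D) && [exists i in D, (i, j) \in arcs G]].

Definition out_restr D G : digraph :=
  (D :|: out_nbrs G D, [set a in arcs G | a.1 \in D]).

Definition trees_on V D : {set digraph} :=
  [set t | is_tree V t && (verts t == D)].

(* The vertex of t outside D has to be the root of t: this is the meaning of
   the circle in T°_D (as opposed to the bullet in T•_D, where the root is in
   D).  The condition on [induced t D] alone would also admit a tree on D
   together with an arc entering D from the additional vertex. *)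
Definition trees_leaving V D : {set digraph} :=
  [set t | [&& is_tree V t, #|verts t| == #|D|.+1, D \subset verts t,
               induced t D \in trees_on V D
             & [forall r, is_root t r ==> (r \notin D)]]].

End Digraphs.

Section SetAlgebra.
Variable T : finType.
Implicit Types (S A : {set {set T}}) (B : {set T}).

Definition is_set_algebra A : bool :=
  [&& [set: T] \in A,
      [forall B in A, ~: B \in A]
    & [forall B in A, forall C in A, B :|: C \in A]].

Definition generated_algebra S : {set {set T}} :=
  \bigcap_(A : {set {set T}} | is_set_algebra A && (S \subset A)) A.

Definition atoms A : {set {set T}} :=
  [set B in A | (B != set0) &&
     [forall C in A, (B :&: C == set0) || (B :&: C == B)]].

End SetAlgebra.

Section Weights.
Variables (R : realFieldType) (T : finType) (V : digraph T) (v : T -> T -> R).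
Implicit Types (G : digraph T) (D X : {set T}) (j k : nat).

Definition weight_on D G : R := \sum_(a in arcs G | a.1 \in D) v a.1 a.2.
Definition weight G : R := weight_on [set: T] G.

(* Minimum over a possibly empty set, in the extended reals; +oo if empty. *)
Definition min_weight (S : {set digraph T}) : \bar R :=
  \big[Order.min/+oo%E]_(G in S) (weight G)%:E.

Definition minimizers (S : {set digraph T}) : {set digraph T} :=
  [set G in S | (weight G)%:E == min_weight S].

Definition phi j : \bar R := min_weight (spanning_forests V j).

Definition min_forests j : {set digraph T} :=
  minimizers (spanning_forests V j).

Definition tree_vertex_sets k : {set {set T}} :=
  [set B | [exists F in min_forests k,
     exists t in components F, B == verts t]].

Definition forest_algebra k : {set {set T}} :=
  generated_algebra (tree_vertex_sets k).

Definition labeled k X : bool :=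
  [exists F in min_forests k, exists t in components F,
     exists r in X, is_root t r].

Definition labeled_atoms k : {set {set T}} :=
  [set X in atoms (forest_algebra k) | labeled k X].

Definition unlabeled_atoms k : {set {set T}} :=
  atoms (forest_algebra k) :\: labeled_atoms k.

Definition min_trees_leaving D : {set digraph T} :=
  minimizers (trees_leaving V D).

End Weights.

(* Main.v *)
Require Import Defs.
From mathcomp Require Import all_boot all_order all_algebra.
From mathcomp Require Import constructive_ereal boolp lra zify.

(* A spanning forest is a map f sending each vertex to the head of its arc.  If C is the vertex set
   of a tree of f, exchanging f and g on C gives two forests again.  For f, g of minimal weight with k
   trees the strict gap forces g to have exactly one root in C, and both exchanges are minimal.
   Given the unlabeled atom X, take trees C, C' of minimal forests f, f' with C \subset C' and X
   inside Y = C' \ C, with Y as small as possible.  Replacing f on C, f' outside C' by any acyclic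
   rootless p on Y yields a k-forest, so p costs on Y at least what any minimal k-forest does.  If p
   attains this, minimality of Y forces all of p to flow either into C or out of C'; mixing p with f
   or f', whichever flows the opposite way, shows that p leaves Y by a single arc.  Hence Y = X.
   Finally a minimal (k-1)-forest has no root in X and attains the minimal cost there. *)

Set Implicit Arguments.
Unset Strict Implicit.
Unset Printing Implicit Defensive.

Import Order.TTheory GRing.Theory Num.Theory.
Local Open Scope ring_scope.

(** * Forests as partial maps: roots, basins and gluing *)

Section Next.
Variable T : finType.
Implicit Types (f g h : T -> option T) (D Y : {set T}) (x y r : T).

(** Induction on [reach] follows the unique path from a vertex to its root. As [T] is finite,
    [rooted] amounts to acyclicity, and the basins of the roots are the vertex sets of the trees. *)
Inductive reach f : T -> T -> Prop :=
| reach_root r : f r = None -> reach f r r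
| reach_step x y r : f x = Some y -> reach f y r -> reach f x r.

Definition rooted f := forall x, exists r, reach f x r.
Definition root_set f : {set T} := [set x | f x == None].
Definition basin f r : {set T} := [set x | connect (fun a b => f a == Some b) x r].
Definition stable f D := forall x y, x \in D -> f x = Some y -> y \in D.
Definition mix D f g x := if x \in D then f x else g x.
(** Arcs not inside [Y] are erased rather than the type being changed, so vertices outside [Y]
    become isolated roots and all lemmas on maps still apply. *)
Definition restr Y f x :=
  if x \in Y then if f x is Some y then if y \in Y then Some y else None
                  else None else None.

(* Every path of f starting in Y leaves Y; the roots of [restr Y f] in Y are
   then the tails of the arcs of f that leave Y. *)
Definition leaving Y f := rooted (restr Y f) /\ forall x, x \in Y -> f x <> None.
Definition exits Y f : {set T} := Y :&: root_set (restr Y f).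

Lemma mem_root_set f x : (x \in root_set f) = (f x == None).
Proof. by rewrite inE. Qed.

Lemma basinP f r x : r \in root_set f -> reflect (reach f x r) (x \in basin f r).
Proof.
rewrite !inE => /eqP fr; apply: (iffP idP).
  case/connectP=> p; elim: p x => [|y p IHp] x /=.
    by move=> _ <-; apply: reach_root.
  by case/andP=> /eqP fx py lp; apply: (reach_step fx); apply: IHp.
move=> xr; elim: xr fr => [s _ _|a b s fa _ IH fs]; first exact: connect0.
by apply: connect_trans (connect1 _) (IH fs); rewrite /= fa.
Qed.

Lemma reach_rootP f x r : reach f x r -> r \in root_set f.
Proof. by elim=> [s fs|//]; rewrite inE fs. Qed.

Lemma reach_inj f x r s : reach f x r -> reach f x s -> r = s.
Proof.
move=> xr; elim: xr s => [t ft s|a b t fa _ IH s] xs.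
  by case: xs ft => // a b u ->.
apply: IH; case: xs fa => [u ->//|u u' t' -> ut' [<-]//].
Qed.

Lemma basin_self f r : r \in basin f r.
Proof. by rewrite inE connect0. Qed.

Lemma basin_inj f r s x : r \in root_set f -> s \in root_set f ->
  x \in basin f r -> x \in basin f s -> r = s.
Proof. by move=> fr fs /(basinP _ fr) xr /(basinP _ fs); apply: reach_inj. Qed.

Lemma rooted_basin f x : rooted f -> exists2 r, r \in root_set f & x \in basin f r.
Proof.
by case/(_ x)=> r xr; have fr := reach_rootP xr; exists r => //; apply/basinP.
Qed.

Lemma root_set_basin f r : r \in root_set f -> root_set f :&: basin f r = [set r].
Proof.
move=> fr; apply/setP=> x; rewrite in_setI in_set1; apply/andP/eqP=> [[fx xr]|->].
  exact: (basin_inj fx fr (basin_self f x) xr).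
by rewrite basin_self.
Qed.

Lemma basin_next f r x y : r \in root_set f -> f x = Some y ->
  (x \in basin f r) = (y \in basin f r).
Proof.
move=> fr fx; apply/basinP/basinP=> //; last exact: reach_step.
by move=> xr; case: xr fx => [s ->|a b s -> bs [<-]].
Qed.

Lemma stable_basin f r : r \in root_set f -> stable f (basin f r).
Proof. by move=> fr x y xC /(basin_next fr) <-. Qed.

Lemma stable_basinC f r : r \in root_set f -> stable f (~: basin f r).
Proof. by move=> fr x y; rewrite !inE => xC /(basin_next fr); rewrite !inE => <-. Qed.

Lemma basin_reach f x r : reach f x r -> forall D, stable f D -> x \in D -> r \in D.
Proof. by elim=> // a b s fa _ IH D stD aD; apply: IH => //; apply: stD aD fa. Qed.

(** A path starting outside [D] stays outside, so it cannot end at [r]. *)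
Lemma basin_sub f r D : r \in root_set f -> stable f (~: D) -> r \in D ->
  basin f r \subset D.
Proof.
move=> fr stD rD; apply/subsetP=> x /(basinP _ fr) xr.
by apply: contraLR rD; rewrite -!in_setC; apply: basin_reach stD.
Qed.

Lemma sub_basin f g r D : r \in root_set f -> r \in root_set g -> stable f D ->
  {in D, f =1 g} -> basin f r :&: D \subset basin g r.
Proof.
move=> fr gr stD fg; apply/subsetP=> x /setIP[/(basinP _ fr) xr xD].
apply/basinP => //; elim: xr gr xD => [s _ gs _|a b s fa _ IH gs aD].
  by apply: reach_root; apply/eqP; rewrite inE in gs.
by apply: (@reach_step _ _ b); [rewrite -fg|apply: IH => //; apply: stD aD fa].
Qed.

(** A path of [h] follows [g] until it first enters [D], and from then on follows [f] without ever
    leaving [D]; both stretches are finite. *)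
Lemma rooted_hybrid D f g h : rooted f -> rooted g -> stable f D ->
  {in D, h =1 f} -> {in ~: D, h =1 g} -> rooted h.
Proof.
move=> rf rg stD hf hg.
have inD x : x \in D -> exists r, reach h x r.
  case: (rf x) => r; elim=> [s fs sD|a b s fa _ IH aD].
    by exists s; apply: reach_root; rewrite hf.
  by have [t bt] := IH (stD _ _ aD fa); exists t; apply: reach_step bt; rewrite hf.
move=> x; case: (rg x) => r; elim=> [s gs|a b s ga _ [t bt]].
  have [/inD//|sD] := boolP (s \in D).
  by exists s; apply: reach_root; rewrite hg ?inE.
have [/inD//|aD] := boolP (a \in D).
by exists t; apply: reach_step bt; rewrite hg ?inE.
Qed.

Lemma rooted_mix D f g : rooted f -> rooted g -> stable f D -> rooted (mix D f g).
Proof.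
move=> rf rg stD; apply: (rooted_hybrid rf rg stD) => x; rewrite /mix ?inE.
  by move=> ->.
by move/negbTE->.
Qed.

Lemma rooted_mixC D f g : rooted f -> rooted g -> stable f (~: D) ->
  rooted (mix D g f).
Proof.
move=> rf rg stD; apply: (rooted_hybrid rf rg stD) => x; rewrite /mix ?inE.
  by move/negbTE->.
by rewrite negbK => ->.
Qed.

(** * Counting roots, and pigeonhole over the basins *)

Lemma card_root_set_mix D f g :
  #|root_set (mix D f g)| = (#|root_set f :&: D| + #|root_set g :\: D|)%N.
Proof.
rewrite -(cardsID D (root_set _)); congr (_ + _)%N.
  by apply: eq_card => x; rewrite !inE /mix; case: (x \in D); rewrite ?andbF.
by apply: eq_card => x; rewrite !inE /mix; case: (x \in D).
Qed.

Lemma card_basin f (A : {set T}) : rooted f ->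
  (\sum_(r in root_set f) #|A :&: basin f r|)%N = #|A|.
Proof.
move=> rf; rewrite -sum1_card.
(* The root of the tree through [x]; its fibres are the basins, over which the sum is split. *)
pose p x := odflt x [pick r in root_set f | x \in basin f r].
have pP x r : r \in root_set f -> (x \in basin f r) = (p x == r).
  move=> fr; have [s fs xs] := rooted_basin x rf.
  rewrite /p; case: pickP => [t /= /andP[ft xt]|/(_ s)]; last by rewrite /= fs xs.
  by apply/idP/eqP=> [|<-//]; apply: basin_inj.
rewrite [RHS](partition_big p (mem (root_set f))) /= => [|x _].
  apply: eq_bigr => r fr; rewrite -sum1_card; apply: eq_bigl => x.
  by rewrite inE pP.
have [r fr xr] := rooted_basin x rf.
by move: (xr); rewrite pP // => /eqP->.
Qed.

(** The counts are all at least 1 and their sum is the number of basins, so equality holds in each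
    term. *)
Lemma card_basin_eq1 f (A : {set T}) : rooted f -> #|A| = #|root_set f| ->
    (forall r, r \in root_set f -> #|A :&: basin f r| != 0%N) ->
  forall r, r \in root_set f -> #|A :&: basin f r| = 1%N.
Proof.
move=> rf cA nz r fr.
have le1 s : s \in root_set f ->
    (1 <= #|A :&: basin f s| ?= iff (1 == #|A :&: basin f s|))%N.
  by move=> fs; split=> //; rewrite lt0n nz.
have [_] := leqif_sum le1; rewrite sum1_card card_basin // cA eqxx.
by move/esym/forallP/(_ r)/implyP/(_ fr)/eqP.
Qed.

Lemma card_basin_eq0 f (A : {set T}) : rooted f -> (#|A| < #|root_set f|)%N ->
  exists2 r, r \in root_set f & #|A :&: basin f r| == 0%N.
Proof.
move=> rf ltA; apply/exists_inP; apply: contraLR ltA => /exists_inPn nz.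
rewrite -leqNgt -(card_basin A rf) -sum1_card; apply: leq_sum => r fr.
by rewrite lt0n; apply: nz.
Qed.

(** * Restriction to a set and the exits from it *)

Lemma rooted_restr D p : rooted p -> rooted (restr D p).
Proof.
move=> rp x; case: (rp x) => s; elim=> [a pa|a b t pa _ [u bu]].
  by exists a; apply: reach_root; rewrite /restr pa if_same.
case pb: (restr D p a) => [b'|]; last by exists a; apply: reach_root.
exists u; apply: (reach_step pb); move: pb; rewrite /restr pa.
by case: ifP => // _; case: ifP => // _ [<-].
Qed.

Lemma restrP D p x y : reflect ([/\ x \in D, y \in D & p x = Some y]) (restr D p x == Some y).
Proof.
rewrite /restr; apply: (iffP eqP) => [|[-> yD ->]]; last by rewrite yD.
by case: ifP => // xD; case: (p x) => // z; case: ifP => // zD [<-].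
Qed.

Lemma exitsP D p z : leaving D p ->
  reflect (z \in D /\ exists2 u, p z = Some u & u \notin D) (z \in exits D p).
Proof.
case=> _ nr; rewrite !inE /restr; apply: (iffP andP) => [[zD]|[zD [u -> /negbTE uD]]].
  rewrite zD; case pz: (p z) => [u|]; last by case: (nr _ zD).
  by case: ifP => // uD _; split=> //; exists u; rewrite ?uD.
by rewrite zD uD.
Qed.

Lemma exits_reach D p x z : reach (restr D p) x z -> x \in D -> z \in exits D p.
Proof.
elim=> [a pa aD|a b t /eqP/restrP[_ bD _] _ IH _]; last exact: IH.
by rewrite !inE aD pa.
Qed.

Lemma leaving_rooted D p : rooted p -> (forall x, x \in D -> p x <> None) -> leaving D p.
Proof. by move=> rp nr; split=> //; apply: rooted_restr. Qed.

Lemma leaving_mix D Z p q : leaving D p -> leaving D q -> stable (restr D p) Z ->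
  leaving D (mix Z p q).
Proof.
move=> [rp np] [rq nq] stZ; split=> [|x xD]; last first.
  by rewrite /mix; case: ifP => _; [apply: np|apply: nq].
apply: (rooted_hybrid rp rq stZ) => x; rewrite /restr /mix; first by move=> ->.
by rewrite inE => /negbTE->.
Qed.

End Next.

(** * Exchange arguments between optimal forests *)

Section Optimal.
Variables (R : realFieldType) (T : finType).
Variables (E : rel T) (c : T -> option T -> R).
Implicit Types (f g h p q : T -> option T) (D Y : {set T}) (x y r s : T).

Definition allowed D f := forall x y, x \in D -> f x = Some y -> E x y.
Definition feasible j f := [/\ rooted f, allowed setT f & #|root_set f| = j].
Definition cost D f := \sum_(x in D) c x (f x).
Definition optimal j f :=
  feasible j f /\ forall g, feasible j g -> cost setT f <= cost setT g.

Lemma eq_cost D f g : {in D, f =1 g} -> cost D f = cost D g.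
Proof. by move=> fg; apply: eq_bigr => x /fg ->. Qed.

Lemma cost_split D Y f : cost Y f = cost (Y :&: D) f + cost (Y :\: D) f.
Proof. exact: big_setID. Qed.

Lemma cost_splitT D f : cost setT f = cost D f + cost (~: D) f.
Proof. by rewrite (cost_split D) setTI setTD. Qed.

Lemma mix_in D f g : {in D, mix D f g =1 f}.
Proof. by move=> x; rewrite /mix => ->. Qed.

Lemma mix_out D f g : {in ~: D, mix D f g =1 g}.
Proof. by move=> x; rewrite /mix inE => /negbTE ->. Qed.

Lemma cost_mix D f g : cost setT (mix D f g) = cost D f + cost (~: D) g.
Proof. by rewrite (cost_splitT D) (eq_cost (@mix_in D f g)) (eq_cost (@mix_out D f g)). Qed.

Lemma allowed_mix D f g : allowed setT f -> allowed setT g ->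
  allowed setT (mix D f g).
Proof. by move=> af ag x y xT; rewrite /mix; case: ifP => _; [apply: af|apply: ag]. Qed.

(** Both [C] and its complement are stable under [f], so neither exchange creates a cycle. The
    counts follow because [r] is the only root of [f] in [C]. *)
Lemma feasible_swap i j f g r : feasible i f -> feasible j g -> r \in root_set f ->
    let C := basin f r in let n := #|root_set g :&: C| in
  feasible (j - n).+1 (mix C f g) /\ feasible (i.-1 + n) (mix C g f).
Proof.
move=> [rf af ci] [rg ag cj] fr C n; split; split; try exact: allowed_mix.
- exact: rooted_mix rf rg (stable_basin fr).
- by rewrite card_root_set_mix root_set_basin // cards1 -cj cardsD.
- exact: rooted_mixC rf rg (stable_basinC fr).
- by rewrite card_root_set_mix cardsD root_set_basin // cards1 ci -/n; lia.
Qed.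

Lemma optimal_le j f g : optimal j f -> feasible j g -> cost setT f <= cost setT g.
Proof. by case=> _; apply. Qed.

Lemma optimal_eq j f g : optimal j f -> feasible j g ->
  cost setT g <= cost setT f -> optimal j g.
Proof. by move=> [_ of_] fg le; split=> // h /of_; apply: le_trans. Qed.

Lemma optimal_cost j f g : optimal j f -> optimal j g -> cost setT f = cost setT g.
Proof. by move=> [ff of_] [fg og]; apply/le_anti; rewrite of_ ?og. Qed.

Variable j : nat.
(** The strict gap for $k=j+1$, that is $2\phi^k<\phi^{k-1}+\phi^{k+1}$, phrased with real costs so
    that infinite values do not occur. *)
Hypothesis gap : forall f g h, optimal j.+1 f -> feasible j g ->
  feasible j.+2 h -> cost setT f + cost setT f < cost setT g + cost setT h.

(** If [g] had no root in some basin of [f], the two exchanges there would have [j] and [j.+2] roots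
    and total cost $2\phi^{j+1}$, against [gap]. So every basin of [f] contains a root of [g], and
    pigeonhole concludes. *)
Lemma one_root f g r : optimal j.+1 f -> optimal j.+1 g -> r \in root_set f ->
  #|root_set g :&: basin f r| = 1%N.
Proof.
move=> of_ og; have [[rf af cf] [rg ag cg]] := (of_.1, og.1).
apply: card_basin_eq1 => // [|s fs]; first by rewrite cf cg.
apply/eqP=> n0; have [] := feasible_swap of_.1 og.1 fs.
rewrite n0 subn0 addn0 => fH fH'.
have := gap of_ fH' fH; rewrite !cost_mix.
have := optimal_cost of_ og.
by rewrite (cost_splitT (basin f s) f) (cost_splitT (basin f s) g); lra.
Qed.

(** By [one_root] both exchanges have [j.+1] roots again. Their costs add up to those of [f] and
    [g], so neither can exceed the minimum. *)
Lemma swap_optimal f g r (C := basin f r) :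
    optimal j.+1 f -> optimal j.+1 g -> r \in root_set f ->
  [/\ optimal j.+1 (mix C f g), optimal j.+1 (mix C g f) & cost C g = cost C f].
Proof.
move=> of_ og fr; have n1 := one_root of_ og fr.
have [] := feasible_swap of_.1 og.1 fr; rewrite n1 subn1 addn1 /= -/C => fH fH'.
have le1 := optimal_le of_ fH; have le2 := optimal_le of_ fH'.
have := optimal_cost of_ og; move: le1 le2.
rewrite !cost_mix (cost_splitT C f) (cost_splitT C g) => le1 le2 e.
by split; [apply: optimal_eq of_ fH _|apply: optimal_eq of_ fH' _|];
  rewrite ?cost_mix ?(cost_splitT C f); lra.
Qed.

(** Here the exchanges have [j.+1] and [j] roots, the same two numbers as [f] and [f0]. The total
    cost is preserved, so both are optimal, and on [C] the map [f0] pays the full difference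
    $\phi^j-\phi^{j+1}$. *)
Lemma swap_empty f0 f r (C := basin f r) :
    optimal j f0 -> optimal j.+1 f -> r \in root_set f -> #|root_set f0 :&: C| = 0%N ->
  optimal j.+1 (mix C f f0) /\
  cost C f0 = cost C f + (cost setT f0 - cost setT f).
Proof.
move=> o0 of_ fr n0.
have [] := feasible_swap of_.1 o0.1 fr; rewrite n0 subn0 addn0 /= -/C => fH fH'.
have le1 := optimal_le of_ fH; have le2 := optimal_le o0 fH'.
move: le1 le2; rewrite !cost_mix (cost_splitT C f) (cost_splitT C f0) => le1 le2.
by split; [apply: optimal_eq of_ fH _; rewrite cost_mix (cost_splitT C f)|]; lra.
Qed.

Lemma swap_single f0 f r (C := basin f r) : (0 < j)%N ->
    optimal j f0 -> optimal j.+1 f -> r \in root_set f -> #|root_set f0 :&: C| = 1%N ->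
  cost C f0 = cost C f.
Proof.
move=> j0 o0 of_ fr n1.
have [] := feasible_swap of_.1 o0.1 fr; rewrite n1 subn1 addn1 /= prednK // -/C => fH fH'.
have le1 := optimal_le o0 fH; have le2 := optimal_le of_ fH'.
by move: le1 le2; rewrite !cost_mix (cost_splitT C f) (cost_splitT C f0); lra.
Qed.

(** Having fewer roots than [f], [f0] misses some basin of [f]. Copying [f] there gives an optimal
    map with [j.+1] roots, to which [one_root] applies; it agrees with [f0] on every other basin of
    [f]. *)
Lemma root_set_le1 f0 f r : optimal j f0 -> optimal j.+1 f -> r \in root_set f ->
  #|root_set f0 :&: basin f r| = 0%N \/ #|root_set f0 :&: basin f r| = 1%N.
Proof.
move=> o0 of_ fr; have [[r0 _ c0] [rf _ cf]] := (o0.1, of_.1).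
have [|s fs /eqP ns] := card_basin_eq0 rf (A := root_set f0); first by rewrite c0 cf.
have [<-|ne] := eqVneq s r; [by left|right].
have [oH _] := swap_empty o0 of_ fs ns.
rewrite -(one_root of_ oH fr); apply: eq_card => x.
rewrite !in_setI andbC [RHS]andbC !mem_root_set /mix; case: (boolP (x \in basin f r)) => //= xr.
by rewrite ifN //; apply: contra_neqN ne => xs; apply: basin_inj xs xr.
Qed.


(** * The unlabeled atom and nested pairs of trees around it *)

Variable X : {set T}.
(** These four properties are the only form in which the unlabeled atom enters the argument; they
    are derived from the algebra at the very end. *)
Hypothesis X_neq0 : X != set0.
Hypothesis X_rootless : forall f, optimal j.+1 f -> {in X, forall x, f x <> None}.
Hypothesis X_unsplit : forall f r, optimal j.+1 f -> r \in root_set f ->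
  {in X &, forall x y, (x \in basin f r) = (y \in basin f r)}.
Hypothesis X_separated : forall x y, x \in X -> y \notin X ->
  exists f r, [/\ optimal j.+1 f, r \in root_set f & (x \in basin f r) != (y \in basin f r)].

(** In a map whose trees tell [x] from [y], the tree through [y] misses [x], hence all of [X]. *)
Lemma separating x y : x \in X -> y \notin X ->
  exists f r, [/\ optimal j.+1 f, r \in root_set f, y \in basin f r & [disjoint X & basin f r]].
Proof.
move=> xX yX; have [f [r [of_ fr ne]]] := X_separated xX yX.
have [s fs ys] := rooted_basin y (let: And3 rf _ _ := of_.1 in rf).
exists f, s; split=> //; rewrite disjoints_subset; apply/subsetP=> z zX.
rewrite inE (X_unsplit of_ fs zX xX); apply: contra ne => xs.
apply/eqP; apply/idP/idP=> [xr|yr].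
  by rewrite (basin_inj fr fs xr xs).
by rewrite (basin_inj fr fs yr ys).
Qed.

Lemma X_sub_basin f r x : optimal j.+1 f -> r \in root_set f ->
  x \in X -> x \in basin f r -> X \subset basin f r.
Proof.
by move=> of_ fr xX xr; apply/subsetP=> y yX; rewrite (X_unsplit of_ fr yX xX).
Qed.

Lemma X_disj_basin f r x : optimal j.+1 f -> r \in root_set f ->
  x \in X -> x \notin basin f r -> X \subset ~: basin f r.
Proof.
by move=> of_ fr xX xr; apply/subsetP=> y yX; rewrite inE (X_unsplit of_ fr yX xX).
Qed.

Definition nested f r f' r' :=
  [/\ optimal j.+1 f /\ r \in root_set f, optimal j.+1 f' /\ r' \in root_set f',
      basin f r \subset basin f' r' & X \subset basin f' r' :\: basin f r].

(** The tree of [f] containing [X] has its root [r] outside [X]. A tree [B] of some optimal [g]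
    contains [r] and misses [X]. Copying [f] into [g] on [B] gives an optimal map whose tree at [r]
    lies in [B] and in the tree of [f]. *)
Lemma nested_exists f : optimal j.+1 f -> exists g s f' r', nested g s f' r'.
Proof.
move=> of_; have [x xX] := set0Pn _ X_neq0.
have [r fr xr] := rooted_basin x (let: And3 rf _ _ := of_.1 in rf).
have rX : r \notin X.
  by apply/negP=> /(X_rootless of_); apply; apply/eqP; rewrite -mem_root_set.
have [g [s [og gs rs dis]]] := separating xX rX.
have [_ oH _] := swap_optimal og of_ gs.
set B := basin g s in rs dis oH *.
have Hr : r \in root_set (mix B f g) by rewrite inE mix_in // -mem_root_set.
have sub : basin (mix B f g) r \subset B :&: basin f r.
  apply: basin_sub => //; last by rewrite inE rs basin_self.
  move=> y z; rewrite !in_setC !in_setI !negb_and /mix; case: ifP => [yB /= yr fy|yB _ gy].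
    by rewrite -(basin_next fr fy) yr orbT.
  by rewrite -(basin_next gs gy) -/B yB.
have [subB subf] := subsetIP sub.
exists (mix B f g), r, f, r; split=> //; apply/subsetP=> y yX.
rewrite inE (subsetP (X_sub_basin of_ fr xX xr)) // andbT.
by apply/negP=> /(subsetP subB); rewrite (disjointFr dis yX).
Qed.

(** * A nested pair with the smallest difference *)

Section Minimal.
Variables (f f' : T -> option T) (r r' : T).
Let C := basin f r.
Let C' := basin f' r'.
Let Y := C' :\: C.
Hypothesis ff' : nested f r f' r'.
Hypothesis minimal : forall g s g' s', nested g s g' s' ->
  (#|Y| <= #|basin g' s' :\: basin g s|)%N.

Let of_ : optimal j.+1 f. Proof. by case: ff' => [[]]. Qed.
Let fr : r \in root_set f. Proof. by case: ff' => [[]]. Qed.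
Let of' : optimal j.+1 f'. Proof. by case: ff' => [_ []]. Qed.
Let fr' : r' \in root_set f'. Proof. by case: ff' => [_ []]. Qed.
Let CC' : C \subset C'. Proof. by case: ff'. Qed.
Let XY : X \subset Y. Proof. by case: ff'. Qed.

Definition patch p := mix C f (mix C' p f').

Lemma patch_C p : {in C, patch p =1 f}.
Proof. exact: mix_in. Qed.

Lemma patch_Y p : {in Y, patch p =1 p}.
Proof. by move=> x /setDP[xC' xC]; rewrite /patch /mix (negbTE xC) xC'. Qed.

Lemma patch_C' p : {in ~: C', patch p =1 f'}.
Proof.
move=> x; rewrite inE => xC'; rewrite /patch /mix (negbTE xC') ifN //.
by apply: contraNN xC'; apply: (subsetP CC').
Qed.

Lemma cost_patch p :
  cost setT (patch p) = cost C f + cost Y p + cost (~: C') f'.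
Proof.
rewrite (cost_splitT C') (cost_split C C') (setIidPr CC') -/Y.
by rewrite (eq_cost (@patch_C p)) (eq_cost (@patch_Y p)) (eq_cost (@patch_C' p)).
Qed.

(** By [swap_optimal], [g] costs as much as [f] on [C] and as [f'] on [C']; equal totals then give
    equality with [f'] outside [C']. *)
Lemma cost_ring g : optimal j.+1 g -> cost C f + cost Y g + cost (~: C') f' = cost setT g.
Proof.
move=> og; have [_ _] := swap_optimal of_ og fr; rewrite -/C => eC.
have [_ _] := swap_optimal of' og fr'; rewrite -/C' => eC'.
have := optimal_cost og of'; have := cost_split C C' g.
by rewrite (setIidPr CC') -/Y !(cost_splitT C'); lra.
Qed.

(** A path that leaves [Y] lands in [C], which [f] never leaves, or outside [C'], where [f']
    stays. *)
Lemma rooted_patch p : leaving Y p -> rooted (patch p).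
Proof.
case=> rp nr; have [[rf _ _] [rf' _ _]] := (of_.1, of'.1).
have outC' x : x \notin C' -> exists s, reach (patch p) x s.
  have [s] := rf' x; elim=> [a fa aC'|a b t fa _ IH aC'].
    by exists a; apply: reach_root; rewrite patch_C' ?in_setC.
  have [|u bu] := IH; first by rewrite -(basin_next fr' fa).
  by exists u; apply: reach_step bu; rewrite patch_C' ?in_setC.
have inC x : x \in C -> exists s, reach (patch p) x s.
  have [s] := rf x; elim=> [a fa aC|a b t fa _ IH aC].
    by exists a; apply: reach_root; rewrite patch_C.
  have [|u bu] := IH; first by rewrite -/C -(basin_next fr fa).
  by exists u; apply: reach_step bu; rewrite patch_C.
move=> x; have [/inC//|xC] := boolP (x \in C); have [xC'|/outC'//] := boolP (x \in C').
have: x \in Y by rewrite in_setD xC.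
case: (rp x) => s; elim=> [a + aY|a b t /eqP/restrP[aY bY pa] _ IH _]; last first.
  by have [u bu] := IH bY; exists u; apply: reach_step bu; rewrite patch_Y.
rewrite /restr aY; case pa: (p a) => [b|]; last by case: (nr _ aY).
case: ifP => // bY _; suff [u bu]: exists u, reach (patch p) b u.
  by exists u; apply: reach_step bu; rewrite patch_Y.
by have [/inC//|bC] := boolP (b \in C); apply: outC'; move: bY; rewrite in_setD bC /= => ->.
Qed.

Lemma feasible_patch p : leaving Y p -> allowed Y p -> feasible j.+1 (patch p).
Proof.
move=> lp ap; have [[rf af cf] [rf' af' cf']] := (of_.1, of'.1).
split; first exact: rooted_patch.
  move=> x y _; have [xC|xC] := boolP (x \in C); first by rewrite patch_C //; apply: af.
  have [xC'|xC'] := boolP (x \in C'); last by rewrite patch_C' ?in_setC //; apply: af'.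
  by rewrite patch_Y ?in_setD ?xC //; apply: ap; rewrite in_setD xC.
(* The root [r] in [C] takes the place of the root [r'] of [f'] in [C']; [p] adds none. *)
rewrite /patch card_root_set_mix root_set_basin // cards1.
rewrite -cf' -(cardsID C' (root_set f')) root_set_basin // cards1; congr addn.
apply: eq_card => x; rewrite !in_setD !mem_root_set /mix.
have := subsetP CC' x; have [xC'|xC'] := boolP (x \in C') => [_|xC].
  have [//|xC] := boolP (x \in C); rewrite /=.
  by apply/negbTE/eqP; apply: lp.2; rewrite in_setD xC.
by have [/xC//|//] := boolP (x \in C).
Qed.

Lemma cost_leaving p g : optimal j.+1 g -> leaving Y p -> allowed Y p ->
  cost Y g <= cost Y p.
Proof.
move=> og lp ap; have := optimal_le og (feasible_patch lp ap).
by rewrite cost_patch -(cost_ring og); lra.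
Qed.

Lemma optimal_patch p g : optimal j.+1 g -> leaving Y p -> allowed Y p ->
  cost Y p = cost Y g -> optimal j.+1 (patch p).
Proof.
move=> og lp ap e; apply: (optimal_eq og (feasible_patch lp ap)).
by rewrite cost_patch -(cost_ring og) e.
Qed.

Lemma r_root_patch p : r \in root_set (patch p).
Proof. by rewrite mem_root_set patch_C ?basin_self // -mem_root_set. Qed.

(* Otherwise the tree of [patch p] rooted at [r], strictly between [C] and [C'],
   would give a smaller nested pair. *)
Lemma patch_exits p : optimal j.+1 (patch p) -> forall z1 u1 z2 u2,
    z1 \in Y -> p z1 = Some u1 -> u1 \notin Y ->
    z2 \in Y -> p z2 = Some u2 -> u2 \notin Y ->
  (u1 \in C) = (u2 \in C).
Proof.
move=> oq; have qr := r_root_patch p.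
have CC1 : C \subset basin (patch p) r.
  rewrite -{1}[C]setIid; apply: sub_basin => //; first exact: stable_basin.
  by move=> x /(@patch_C p) ->.
have C1C' : basin (patch p) r \subset C'.
  apply: basin_sub => //; last by apply: (subsetP CC'); apply: basin_self.
  by move=> x y xC'; rewrite patch_C' //; apply: stable_basinC.
have [x xX] := set0Pn _ X_neq0.
have [xC1|xC1] := boolP (x \in basin (patch p) r).
  (* Minimality for the pair of [C] and the new tree forces this tree to contain all of [Y], so
     every exit from [Y] enters [C]. *)
  suff eY : Y = basin (patch p) r :\: C.
    have inC z u : z \in Y -> p z = Some u -> u \notin Y -> u \in C.
      move=> zY pz; rewrite {1}eY in_setD; apply: contraNT => ->.
      move: (zY); rewrite {1}eY => /setDP[zC1 _] /=.
      by rewrite -(@basin_next _ _ _ z u) // patch_Y.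
    by move=> z1 u1 z2 u2 z1Y pz1 u1Y z2Y pz2 u2Y; rewrite (inC _ _ z1Y pz1) ?(inC _ _ z2Y pz2).
  apply/esym/eqP; rewrite eqEcard setSD //=; apply: minimal; split=> //.
  rewrite subsetD (X_sub_basin oq qr xX xC1) /=.
  by have := XY; rewrite subsetD => /andP[].
(* Minimality for the pair of the new tree and [C'] forces this tree to miss [Y], so no arc of [p]
   from [Y] enters [C]. *)
suff eY : Y = C' :\: basin (patch p) r.
  have inC z u : z \in Y -> p z = Some u -> u \in C = false.
    rewrite {1}eY => /setDP[zC' zC1] pz; apply: (contraNF _ (zC1)) => /(subsetP CC1).
    by rewrite -(@basin_next _ _ _ z u) // patch_Y // eY in_setD zC1.
  by move=> z1 u1 z2 u2 z1Y pz1 u1Y z2Y pz2 u2Y; rewrite (inC _ _ z1Y pz1) ?(inC _ _ z2Y pz2).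
apply/esym/eqP; rewrite eqEcard setDS //=; apply: minimal; split=> //.
rewrite subsetD disjoints_subset (X_disj_basin oq qr xX xC1) andbT.
by have := XY; rewrite subsetD => /andP[].
Qed.

Lemma cost_mixY Z p q : cost Y (mix Z p q) = cost (Y :&: Z) p + cost (Y :\: Z) q.
Proof.
rewrite (cost_split Z); congr (_ + _); apply: eq_cost => x /[!inE] /andP[].
  by move=> _ /mix_in.
by move=> xZ _; rewrite mix_out ?inE.
Qed.

Lemma allowed_mixY Z p q : allowed Y p -> allowed Y q -> allowed Y (mix Z p q).
Proof. by move=> ap aq x y xY; rewrite /mix; case: ifP => _; [apply: ap|apply: aq]. Qed.

(** The mixes along [Z] and along its complement together cost as much as [p] and [q], twice the
    minimum, and neither lies below the minimum. *)
Lemma cost_swap Z p q g : optimal j.+1 g -> leaving Y p -> leaving Y q ->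
    allowed Y p -> allowed Y q -> cost Y p = cost Y g -> cost Y q = cost Y g ->
  stable (restr Y p) Z -> stable (restr Y p) (~: Z) -> cost Y (mix Z p q) = cost Y g.
Proof.
move=> og lp lq ap aq ep eq stZ stZC.
have := cost_leaving og (leaving_mix lp lq stZ) (allowed_mixY ap aq).
have := cost_leaving og (leaving_mix lp lq stZC) (allowed_mixY ap aq).
move: ep eq; rewrite !cost_mixY (cost_split Z Y p) (cost_split Z Y q).
by rewrite -[Y :&: ~: Z]setDE [Y :\: ~: Z]setDE setCK; lra.
Qed.

(** The one root of [g] in [C'] is already its one root in [C], so none lies in [Y]. *)
Lemma Y_leaving g : optimal j.+1 g -> leaving Y g.
Proof.
move=> og; have [rg _ _] := og.1; apply: leaving_rooted rg _ => x xY gx.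
have gx' : x \in root_set g by rewrite inE gx.
have [n1 n1'] := (one_root of_ og fr, one_root of' og fr').
have: root_set g :&: C = root_set g :&: C'.
  by apply/eqP; rewrite eqEcard setIS //= n1 n1'.
move/setP/(_ x); rewrite !in_setI gx' /=.
by case/setDP: xY => -> /negbTE ->.
Qed.

Lemma Y_cost g : optimal j.+1 g -> cost Y g = cost Y f.
Proof.
by move=> og; have := optimal_cost og of_; rewrite -!cost_ring //; lra.
Qed.

Lemma single_exit p : leaving Y p -> allowed Y p -> cost Y p = cost Y f ->
  {in exits Y p &, forall z1 z2, z1 = z2}.
Proof.
move=> lp ap ep z1 z2 z1E z2E.
have [z1Y [u1 pz1 u1Y]] := exitsP _ lp z1E.
(* A map flowing the other way than [p] at [z1]: arcs of [f] starting outside [C] never enter [C],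
   while arcs of [f'] leaving [Y] stay in [C'] and so enter [C]. *)
have [q [lq aq eq qC]] : exists q, [/\ leaving Y q, allowed Y q, cost Y q = cost Y f &
    forall z u, z \in Y -> q z = Some u -> u \notin Y -> (u \in C) = (u1 \notin C)].
  have [u1C|u1C] := boolP (u1 \in C).
    exists f; split=> // [|x y _|z u /setDP[_ zC] fz _].
    - exact: Y_leaving.
    - by apply: (let: And3 _ af _ := of_.1 in af); rewrite inE.
    by apply/negbTE; rewrite -(basin_next fr fz).
  exists f'; split=> // [|x y _||z u /setDP[zC' _] fz].
  - exact: Y_leaving.
  - by apply: (let: And3 _ af _ := of'.1 in af); rewrite inE.
  - exact: Y_cost.
  by rewrite in_setD -(basin_next fr' fz) zC' andbT negbK.
have [x xX] := set0Pn _ X_neq0.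
have xY := subsetP XY x xX.
have [z' xz'] := lq.1 x; have /(exitsP _ lq)[z'Y [u' qz' u'Y]] := exits_reach xz' xY.
(* Otherwise the mix of [p] on the basin of [z] with [q] elsewhere has minimal cost on [Y] and exits
   both at [z] and at [z'], in opposite directions, against [patch_exits]. All basins of exits of
   [p] thus share the vertex [z']. *)
have key z : z \in exits Y p -> z' \in basin (restr Y p) z.
  move=> zE; have [zY [u pz uY]] := exitsP _ lp zE.
  have zr : z \in root_set (restr Y p) by case/setIP: zE.
  have [stZ stZC] := (stable_basin zr, stable_basinC zr).
  set Z := basin _ _ in stZ stZC *.
  have lm := leaving_mix lp lq stZ; have am := allowed_mixY (Z := Z) ap aq.
  have em := cost_swap of_ lp lq ap aq ep eq stZ stZC.
  apply: contraT => z'Z.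
  have e1 := patch_exits (optimal_patch of_ lp ap ep) zY pz uY z1Y pz1 u1Y.
  have := patch_exits (optimal_patch of_ lm am em) zY _ uY z'Y _ u'Y.
  rewrite mix_in; last exact: basin_self.
  rewrite mix_out ?in_setC // => /(_ pz qz').
  by rewrite e1 (qC _ _ z'Y qz' u'Y); case: (u1 \in C).
have [/setIP[_ r1] /setIP[_ r2]] := (z1E, z2E).
exact: basin_inj r1 r2 (key _ z1E) (key _ z2E).
Qed.

(** If [Y] had a vertex outside [X], a tree of some optimal [g] would separate it from a vertex of
    [X]. But [g] leaves [Y] through one exit, so both vertices lie in the tree of that exit. *)
Lemma Y_eq_X : Y = X.
Proof.
apply/eqP; rewrite eqEsubset XY andbT; apply/subsetP=> y yY.
apply: contraT => yX; have [x xX] := set0Pn _ X_neq0.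
have [g [s [og gs]]] := X_separated xX yX; case/eqP.
have lg := Y_leaving og; have xY := subsetP XY x xX.
have ag : allowed Y g.
  by move=> a b _; apply: (let: And3 _ af _ := og.1 in af); rewrite inE.
have trace a b : reach (restr Y g) a b -> (a \in basin g s) = (b \in basin g s).
  by elim=> // a' b' t /eqP/restrP[_ _ /(basin_next gs) ->].
have [[z xz] [z' yz']] := (lg.1 x, lg.1 y).
rewrite (trace _ _ xz) (trace _ _ yz').
by rewrite (single_exit lg ag (Y_cost og) (exits_reach xz xY) (exits_reach yz' yY)).
Qed.

Lemma minimal_leaving f0 : (0 < j)%N -> optimal j f0 ->
  [/\ leaving X f0, {in exits X f0 &, forall z1 z2, z1 = z2} &
      forall p, leaving X p -> allowed X p -> cost X f0 <= cost X p].
Proof.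
move=> j0 o0; rewrite -Y_eq_X.
have [r0 a0 _] := o0.1.
have a0Y : allowed Y f0 by move=> a b _; apply: a0; rewrite inE.
have e1 := cost_split C C' f0; have e2 := cost_split C C' f.
rewrite (setIidPr CC') -/Y in e1 e2.
have eC' : cost C' f = cost C' f'.
  by have [_ _] := swap_optimal of' of_ fr'.
have rootless : root_set f0 :&: C = root_set f0 :&: C' -> leaving Y f0.
  move=> eR; apply: leaving_rooted r0 _ => x /setDP[xC' /negbTE xC] fx.
  by move/setP/(_ x): eR; rewrite !in_setI xC' xC mem_root_set fx.
have sub : root_set f0 :&: C \subset root_set f0 :&: C' by rewrite setIS.
suff [l0 e0] : leaving Y f0 /\ cost Y f0 = cost Y f.
  split=> // [|p lp ap]; first exact: single_exit.
  by rewrite e0; apply: cost_leaving.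
(* With no root of [f0] in [C'], the excess $\phi^j-\phi^{j+1}$ occurs on both [C] and [C'] and
   cancels on [Y]; with one root in each, there is no excess on either. *)
have [n'|n'] := root_set_le1 o0 of' fr'.
  have n : #|root_set f0 :&: C| = 0%N.
    by apply/eqP; rewrite -leqn0 -n' subset_leq_card.
  split; first by apply: rootless; apply/eqP; rewrite eqEcard sub n'.
  have [_] := swap_empty o0 of' fr' n'; have [_] := swap_empty o0 of_ fr n.
  have := optimal_cost of_ of'; rewrite -/C -/C'; lra.
have [n|n] := root_set_le1 o0 of_ fr; last first.
  split; first by apply: rootless; apply/eqP; rewrite eqEcard sub n' n.
  have := swap_single j0 o0 of' fr' n'; have := swap_single j0 o0 of_ fr n.
  rewrite -/C -/C'; lra.
(* Swapping in [C] would leave two roots in [C']. *)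
have [oH _] := swap_empty o0 of_ fr n.
have := one_root of' oH fr'; move/eqP/cards1P => [t /setP et].
have [s /setIP[s0 sC']] : exists s, s \in root_set f0 :&: C'.
  by apply/set0Pn; rewrite -card_gt0 n'.
have sC : s \notin C.
  by apply/negP=> sC; move/eqP: n; rewrite cards_eq0 => /eqP/setP/(_ s); rewrite in_setI s0 sC inE.
have st : s = t.
  apply/set1P; rewrite -et in_setI sC' andbT mem_root_set.
  by rewrite mix_out ?in_setC // -mem_root_set.
have rt : r = t.
  apply/set1P; rewrite -et in_setI (subsetP CC') ?basin_self // andbT mem_root_set.
  by rewrite mix_in ?basin_self // -mem_root_set.
by rewrite st -rt basin_self in sC.
Qed.

End Minimal.

Lemma optimal_leaving f f0 : (0 < j)%N -> optimal j.+1 f -> optimal j f0 ->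
  [/\ leaving X f0, {in exits X f0 &, forall z1 z2, z1 = z2} &
      forall p, leaving X p -> allowed X p -> cost X f0 <= cost X p].
Proof.
move=> j0 of_ o0.
(* Reflection into [bool] lets [ex_minnP] pick the smallest difference. *)
pose P n := `[< exists g s g' s', nested g s g' s' /\ #|basin g' s' :\: basin g s| = n >].
have exP : exists n, P n.
  have [g [s [g' [s' ne]]]] := nested_exists of_.
  by exists #|basin g' s' :\: basin g s|; apply/asboolP; exists g, s, g', s'.
have [n /asboolP[g [s [g' [s' [ne <-]]]]] nmin] := ex_minnP exP.
apply: (minimal_leaving ne) => // h t h' t' ne'; apply: nmin.
by apply/asboolP; exists h, t, h', t'.
Qed.

End Optimal.

(** * Translation between digraphs and partial maps *)

Section Graphs.
Variable T : finType.
Implicit Types (V G F t : digraph T) (f : T -> option T) (D X : {set T}) (x y r : T).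

Definition next G x := [pick y | (x, y) \in arcs G].
Definition graph_of f : digraph T := ([set: T], [set a | f a.1 == Some a.2]).

Lemma nextE G x y : out_at_most_one G -> (next G x == Some y) = ((x, y) \in arcs G).
Proof.
move/forallP/(_ x)/card_le1_eqP => out1; rewrite /next.
case: pickP => [z xz|->//]; apply/eqP/idP => [[<-]//|xy].
by congr Some; apply: out1; rewrite inE.
Qed.

Lemma next_None G x y : next G x = None -> (x, y) \notin arcs G.
Proof. by rewrite /next; case: pickP => // /(_ y) /= ->. Qed.

Lemma next_graph_of f : next (graph_of f) =1 f.
Proof.
move=> x; rewrite /next; case: pickP => [y|no]; first by rewrite inE => /eqP.
by case fx: (f x) => [y|//]; have := no y; rewrite inE /= fx eqxx.
Qed.

Lemma graph_of_out f : out_at_most_one (graph_of f).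
Proof.
apply/forallP=> x; apply/card_le1_eqP => y z.
by rewrite !inE /= => /eqP-> /eqP[].
Qed.

(** Induction on the number of vertices reachable from [x]: it drops along an arc, since the
    successor cannot reach [x] again. *)
Lemma acyclic_rooted G : out_at_most_one G -> acyclic G -> rooted (next G).
Proof.
move=> out1 acG x; have [n] := ubnP #|connect (arc_rel G) x|; elim: n x => // n IH x.
rewrite ltnS => le; case xy: (next G x) => [y|]; last by exists x; apply: reach_root.
have {}Exy : arc_rel G x y by rewrite /arc_rel /= -nextE // xy.
have [|r yr] := IH y; last by exists r; apply: reach_step yr.
apply: leq_trans le; apply: proper_card; apply/properP; split.
  by apply/subsetP=> z; apply: connect_trans; apply: connect1.
exists x; first exact: connect0.
by move/forallP/(_ x)/forallP/(_ y)/implyP/(_ Exy): acG.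
Qed.

(** A cycle through [x] also passes through the successor of [x], so it can be pushed along the path
    to the root, which has no outgoing arc. *)
Lemma rooted_acyclic G f : rooted f ->
  (forall x y, (x, y) \in arcs G -> f x = Some y) -> acyclic G.
Proof.
move=> rf Gf; apply/forallP=> x; apply/forallP=> y; apply/implyP=> xy.
apply/negP=> yx; have [r xr] := rf x.
elim: xr y xy yx => {x r} [r fr y /Gf|x b r fx _ IH y xy]; first by rewrite fr.
have := Gf _ _ xy; rewrite fx => -[eb]; rewrite -{}eb in xy *.
case/connectP => [[_ /= xb|b' p /= /andP[bb' bp] xE]].
  by rewrite xb in xy; apply: (IH b xy); apply: connect0.
apply: (IH b' bb'); apply: (@connect_trans _ _ x); last exact: connect1.
by apply/connectP; exists p.
Qed.

Lemma connect_basin G r x : out_at_most_one G -> x \in basin (next G) r ->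
  connect (arc_rel G) x r.
Proof.
move=> out1; rewrite inE; congr (is_true _); apply: eq_connect => a b.
by rewrite /arc_rel /= nextE.
Qed.

Lemma connect_adj G x y : connect (arc_rel G) x y -> connect (adj_rel G) x y.
Proof. by apply: connect_sub => a b ab; apply/connect1/orP; left. Qed.

Lemma adj_sym G : connect_sym (adj_rel G).
Proof. by apply: sym_connect_sym => x y; apply: orbC. Qed.

(** A basin is closed under arcs in both directions, hence under weak connection. *)
Lemma adj_basin G r x : out_at_most_one G -> r \in root_set (next G) ->
  connect (adj_rel G) r x = (x \in basin (next G) r).
Proof.
move=> out1 rr; apply/idP/idP=> [rx|/(connect_basin out1)/connect_adj]; last first.
  by rewrite adj_sym.
rewrite -(closed_connect _ rx) ?basin_self // => a b.
case/orP; rewrite /arc_rel /= -nextE // => /eqP ab; first exact: basin_next.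
by apply/esym; apply: basin_next.
Qed.

Lemma comp_vertsE G : out_at_most_one G -> acyclic G -> verts G = [set: T] ->
  comp_verts G = [set basin (next G) r | r in root_set (next G)].
Proof.
move=> out1 acG GT.
have eC x : [set y in verts G | connect (adj_rel G) x y] =
    [set y | connect (adj_rel G) x y] by apply/setP=> y; rewrite !inE GT inE.
apply/setP=> C; apply/imsetP/imsetP=> [[x _ ->]|[r rr ->]]; last first.
  exists r; first by rewrite GT inE.
  by apply/setP=> x; rewrite eC [RHS]inE adj_basin.
have [r rr xr] := rooted_basin x (acyclic_rooted out1 acG).
exists r => //; apply/setP=> y; rewrite eC [LHS]inE -adj_basin //.
have: connect (adj_rel G) r x by rewrite adj_basin.
by move/(same_connect (@adj_sym G)) ->.
Qed.

Lemma verts_induced G C : C \in comp_verts G -> verts (induced G C) = C.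
Proof.
case/imsetP=> x _ ->; apply/setIidPr/subsetP=> y.
by rewrite inE => /andP[].
Qed.

Lemma card_components G : #|components G| = #|comp_verts G|.
Proof.
by apply: card_in_imset => C D /verts_induced {2}<- /verts_induced {2}<- ->.
Qed.

Lemma card_comp_verts G : out_at_most_one G -> acyclic G -> verts G = [set: T] ->
  #|components G| = #|root_set (next G)|.
Proof.
move=> out1 acG GT; rewrite card_components comp_vertsE //.
by apply: card_in_imset => r s rr ss e; apply: (@basin_inj _ (next G) r s r); rewrite // -?e basin_self.
Qed.

Lemma spanning_forestsP V F j : verts V = [set: T] -> F \in spanning_forests V j ->
  [/\ verts F = [set: T], out_at_most_one F & feasible (arc_rel V) j (next F)].
Proof.
move=> VT; rewrite inE => /and3P[/and3P[/and3P[_ _ sub] out1 acF] /eqP FV /eqP cF].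
have FT : verts F = [set: T] by rewrite FV.
split=> //; split; [exact: acyclic_rooted| |by rewrite -card_comp_verts].
by move=> x y _ /eqP; rewrite nextE // => /(subsetP sub).
Qed.

Lemma graph_of_forest V f j : verts V = [set: T] -> feasible (arc_rel V) j f ->
  graph_of f \in spanning_forests V j.
Proof.
move=> VT [rf af cf].
have acf : acyclic (graph_of f).
  by apply: rooted_acyclic rf _ => x y; rewrite inE => /eqP.
rewrite inE; apply/and3P; split; last first.
- rewrite card_comp_verts ?graph_of_out // -cf; apply/eqP; apply: eq_card => x.
  by rewrite !inE next_graph_of.
- by rewrite /spanning VT.
apply/and3P; split=> //; last exact: graph_of_out.
apply/and3P; split; first by apply/forallP=> a; apply/implyP; rewrite !inE.
  by rewrite VT.
apply/subsetP=> -[x y]; rewrite inE => /eqP /= fx.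
by apply: (af x y) => //; rewrite inE.
Qed.

Lemma connected_tree V G r : is_forest V G -> r \in verts G ->
  {in verts G, forall x, connect (adj_rel G) x r} -> is_tree V G.
Proof.
move=> FG rG conn; rewrite /is_tree FG card_components.
suff -> : comp_verts G = [set verts G] by rewrite cards1.
have eC x : x \in verts G -> [set y in verts G | connect (adj_rel G) x y] = verts G.
  move=> xG; apply/setP=> y; rewrite inE andb_idr // => yG.
  by apply: connect_trans (conn _ xG) _; rewrite adj_sym; apply: conn.
apply/setP=> C; rewrite in_set1; apply/imsetP/eqP=> [[x xG ->]|->]; first exact: eC.
by exists r; rewrite ?eC.
Qed.

Lemma tree_leaving V X t : t \in trees_leaving V X ->
  [/\ out_at_most_one t, leaving X (next t), allowed (arc_rel V) X (next t)
    & forall x, x \notin X -> next t x = None].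
Proof.
rewrite inE => /and5P[/andP[/and3P[/and3P[/forallP wf _ sub] out1 act] _] ct Xt _ /forallP rX].
have nX x : x \in X -> next t x <> None.
  move=> xX fx; have := rX x; rewrite xX /is_root (subsetP Xt) // implybF => /negP[].
  by apply/forallP=> y; apply: next_None.
have rt := acyclic_rooted out1 act.
have arcP x y : next t x = Some y -> (x, y) \in arcs t by move/eqP; rewrite nextE.
have vt x y : next t x = Some y -> (x \in verts t) /\ (y \in verts t).
  by move/arcP=> xy; have := wf (x, y); rewrite xy => /andP[].
split=> // [|x y _ /arcP/(subsetP sub)//|x xX]; first exact: leaving_rooted.
case fx: (next t x) => [y|//]; have [xt yt] := vt _ _ fx.
have [r xr] := rt x; have rr := reach_rootP xr.
(* Only one vertex of [t] lies outside [X]; the root reached from [x] is such a vertex too, so it is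
   [x] itself. *)
have tX : verts t :\: X = [set x].
  apply/esym/eqP; rewrite eqEcard sub1set inE xX xt cards1 cardsD (setIidPr Xt).
  by rewrite (eqP ct) subSnn.
have rt' : r \in verts t by apply: (basin_reach xr) xt => a b _ /vt[].
have : r \in verts t :\: X.
  by rewrite inE rt' andbT; apply/negP=> /nX; apply; apply/eqP; rewrite -mem_root_set.
by rewrite tX => /set1P rx; move: rr; rewrite rx inE fx.
Qed.

Lemma out_restr_leaving V F X : is_forest V F -> X != set0 -> verts V = [set: T] ->
    leaving X (next F) -> {in exits X (next F) &, forall z1 z2, z1 = z2} ->
  out_restr X F \in trees_leaving V X.
Proof.
move=> /and3P[/and3P[_ _ sub] out1 acF] X0 VT lX uniq.
have [x0 x0X] := set0Pn _ X0.
have nextF x y : next F x = Some y -> (x, y) \in arcs F by move/eqP; rewrite nextE.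
have arcF x y : (x, y) \in arcs F -> next F x = Some y.
  by rewrite -nextE // => /eqP.
have [z x0z] := lX.1 x0; have zE := exits_reach x0z x0X.
have [zX [u zu uX]] := exitsP _ lX zE.
(* Every arc out of [X] starts at the unique exit [z], so its head [u] is the only vertex added to
   [X]. *)
have out : out_nbrs F X = [set u].
  apply/setP=> y; rewrite !inE; apply/andP/eqP=> [[yX /exists_inP[x xX /arcF xy]]|->].
    have xz : x = z by apply: uniq => //; apply/exitsP=> //; split=> //; exists y.
    by move: xy; rewrite xz zu => -[].
  by split=> //; apply/exists_inP; exists z => //; apply: nextF.
set G := out_restr X F.
have vG : verts G = X :|: [set u] by rewrite /G /out_restr /verts out.
have aG x y : ((x, y) \in arcs G) = ((x, y) \in arcs F) && (x \in X) by rewrite inE.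
have aI x y : ((x, y) \in arcs (induced G X)) = [&& (x, y) \in arcs F, x \in X & y \in X].
  by rewrite inE aG /= -andbA; case: (x \in X).
have vI : verts (induced G X) = X by rewrite -[LHS]/(verts G :&: X) vG setUK.
have rF := acyclic_rooted out1 acF.
have subforest H : wf_digraph H -> arcs H \subset arcs F -> is_forest V H.
  move=> wfH HF; apply/and3P; split.
  - by rewrite /subgraph wfH VT subsetT (subset_trans HF sub).
  - apply/forallP=> x; apply: leq_trans (forallP out1 x); apply: subset_leq_card.
    by apply/subsetP=> y; rewrite !inE; apply: (subsetP HF).
  - by apply: rooted_acyclic rF _ => x y /(subsetP HF)/arcF.
have GF : arcs G \subset arcs F by apply/subsetP=> -[x y]; rewrite aG => /andP[].
have IF : arcs (induced G X) \subset arcs F.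
  by apply/subsetP=> -[x y]; rewrite aI => /andP[].
have wfG : wf_digraph G.
  apply/forallP=> -[x y]; apply/implyP; rewrite aG vG !inE => /andP[xy xX]; rewrite xX /=.
  have [//|yX] := boolP (y \in X).
  have : y \in out_nbrs F X by rewrite inE yX; apply/exists_inP; exists x.
  by rewrite out inE.
have wfI : wf_digraph (induced G X).
  by apply/forallP=> -[x y]; apply/implyP; rewrite aI vI => /and3P[_ -> ->].
have conn x : x \in X -> connect (arc_rel (induced G X)) x z.
  move=> xX; have [s xs] := lX.1 x.
  rewrite -(uniq _ _ (exits_reach xs xX) zE); elim: xs => [*|a b t /eqP/restrP[aX bX ab] _].
    exact: connect0.
  by apply: connect_trans; apply: connect1; rewrite /arc_rel /= aI aX bX nextF.
have zG : z \in verts G by rewrite vG inE zX.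
have connG x : x \in X -> connect (adj_rel G) x z.
  move=> xX; apply: connect_adj; apply: connect_sub (conn x xX) => a b.
  by rewrite /arc_rel /= aI => /and3P[ab aX _]; apply: connect1; rewrite /arc_rel /= aG ab.
rewrite inE; apply/and5P; split.
- apply: (connected_tree (subforest _ wfG GF) zG) => x.
  rewrite vG !inE => /orP[/connG//|/eqP->]; rewrite adj_sym.
  by apply/connect_adj/connect1; rewrite /arc_rel /= aG zX nextF.
- by rewrite vG setUC cardsU1 uX.
- by rewrite vG subsetUl.
- rewrite inE vI eqxx andbT.
  apply: (connected_tree (subforest _ wfI IF) (r := z)); first by rewrite vI.
  by move=> x; rewrite vI => /conn; apply: connect_adj.
- apply/forallP=> r; apply/implyP=> /andP[_ /forallP nr].
  apply/negP=> rX; case fr: (next F r) => [y|]; last by case: (lX.2 _ rX).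
  by have := nr y; rewrite aG rX nextF.
Qed.

(** * Atoms of a generated algebra *)

Lemma atom_separated (S : {set {set T}}) X x y : X \in atoms (generated_algebra S) ->
  x \in X -> y \notin X -> exists2 B, B \in S & (x \in B) != (y \in B).
Proof.
rewrite inE => /andP[XA _] xX yX; apply/exists_inP; apply: contraNT yX => /exists_inPn noB.
(* The sets that do not separate [x] from [y] form an algebra; if it contains [S], it contains the
   atom. *)
pose A := [set B : {set T} | (x \in B) == (y \in B)].
suff: X \in A by rewrite inE xX => /eqP <-.
apply: (subsetP _ _ XA); apply: bigcap_inf; apply/andP; split; last first.
  by apply/subsetP=> B /noB; rewrite negbK inE.
apply/and3P; split; first by rewrite !inE.
  by apply/forall_inP=> B; rewrite !inE => /eqP->.
apply/forall_inP=> B; rewrite inE => /eqP xyB; apply/forall_inP=> C; rewrite !inE => /eqP->.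
by rewrite xyB.
Qed.

Lemma atom_unsplit (S : {set {set T}}) X B : X \in atoms (generated_algebra S) ->
  B \in S -> {in X &, forall x y, (x \in B) = (y \in B)}.
Proof.
rewrite inE => /and3P[_ _ /forall_inP split] BS.
have : B \in generated_algebra S by apply/bigcapP=> A /andP[_ /subsetP]; apply.
move/split => /orP[] /eqP XB x y xX yX; move/setP: XB => XB.
  by have := (XB x, XB y); rewrite !inE xX yX /= => -[-> ->].
by have := (XB x, XB y); rewrite !inE xX yX /= => -[-> ->].
Qed.

End Graphs.

(** * Minimal weights as minimal costs *)

Section MinWeight.
Variables (R : realFieldType) (T : finType) (V : digraph T) (v : T -> T -> R).
Implicit Types (G : digraph T) (S : {set digraph T}).

Lemma min_weight_le S G : G \in S -> (min_weight v S <= (weight v G)%:E)%E.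
Proof. exact: bigmin_le_cond. Qed.

Lemma minimizersP S G :
  reflect (G \in S /\ forall H, H \in S -> weight v G <= weight v H) (G \in minimizers v S).
Proof.
rewrite inE; apply: (iffP andP) => [[GS /eqP e]|[GS le]].
  by split=> // H HS; rewrite -lee_fin e min_weight_le.
split=> //; rewrite eq_le min_weight_le // andbT.
by apply: le_bigmin => [|H HS]; rewrite ?leey // lee_fin le.
Qed.

Lemma minimizers_ex S : min_weight v S != +oo%E -> exists G, G \in minimizers v S.
Proof.
have [->|/set0Pn[G0 G0S] _] := eqVneq S set0.
  by rewrite /min_weight big_set0 eqxx.
case: (arg_minP (weight v) G0S) => G GS le.
by exists G; apply/minimizersP; split=> // H /le.
Qed.

(** A root costs nothing, so costs of maps are weights of graphs. *)
Definition arc_cost x (o : option T) : R := if o is Some y then v x y else 0.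

Lemma weight_on_next D G : out_at_most_one G ->
  weight_on v D G = cost arc_cost D (next G).
Proof.
move=> out1; rewrite /weight_on /cost.
transitivity (\sum_(x in D) \sum_(y | (x, y) \in arcs G) v x y).
  by rewrite pair_big_dep /=; apply: eq_bigl => -[x y]; rewrite andbC.
apply: eq_bigr => x _; rewrite (eq_bigl (fun y => next G x == Some y)) => [|y]; last first.
  by rewrite nextE.
case fx: (next G x) => [y|]; last by rewrite big_pred0.
by rewrite (eq_bigl (pred1 y)) ?big_pred1_eq // => z; rewrite /= eq_sym.
Qed.

Lemma weight_next G : out_at_most_one G -> weight v G = cost arc_cost setT (next G).
Proof. exact: weight_on_next. Qed.

Lemma weight_out_restr X G : out_at_most_one G ->
  weight v (out_restr X G) = cost arc_cost X (next G).
Proof.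
move=> out1; rewrite -weight_on_next // /weight /weight_on.
by apply: eq_bigl => a; rewrite !inE andbT.
Qed.


Hypothesis VT : verts V = [set: T].

Lemma min_forests_optimal F j : F \in min_forests V v j ->
  [/\ verts F = [set: T], out_at_most_one F, is_forest V F,
      optimal (arc_rel V) arc_cost j (next F) & weight v F = cost arc_cost setT (next F)].
Proof.
case/minimizersP=> FS le; have [FT out1 feas] := spanning_forestsP VT FS.
split=> //; last exact: weight_next; first by move: FS; rewrite inE => /and3P[].
split=> // g /(graph_of_forest VT)/le; rewrite !weight_next ?graph_of_out //.
by rewrite (eq_cost _ (f := next (graph_of g)) (g := g)) // => x _; apply: next_graph_of.
Qed.

Lemma weight_graph_of f : weight v (graph_of f) = cost arc_cost setT f.
Proof.
rewrite weight_next ?graph_of_out //.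
by apply: eq_cost => x _; apply: next_graph_of.
Qed.

Lemma graph_of_min f j : optimal (arc_rel V) arc_cost j f -> graph_of f \in min_forests V v j.
Proof.
case=> ff le; apply/minimizersP; split=> [|H HS]; first exact: graph_of_forest.
have [_ out1 feas] := spanning_forestsP VT HS.
by rewrite weight_graph_of weight_next //; apply: le.
Qed.

Lemma tree_vertex_setsP k B :
  reflect (exists f r, [/\ optimal (arc_rel V) arc_cost k f, r \in root_set f & B = basin f r])
          (B \in tree_vertex_sets V v k).
Proof.
rewrite inE; apply: (iffP exists_inP) => [[F Fmin /exists_inP[t tF /eqP ->]]|[f [r [of_ fr ->]]]].
  have [FT out1 /and3P[_ _ acF] oF _] := min_forests_optimal Fmin.
  case/imsetP: tF => C CF ->; rewrite verts_induced //.
  move: CF; rewrite comp_vertsE // => /imsetP[r rr ->].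
  by exists (next F), r.
have Fmin := graph_of_min of_; exists (graph_of f) => //.
have [FT out1 /and3P[_ _ acF] oF _] := min_forests_optimal Fmin.
have CF : basin f r \in comp_verts (graph_of f).
  have eN : next (graph_of f) = f by apply/funext/next_graph_of.
  by rewrite comp_vertsE // eN; apply: imset_f.
apply/exists_inP; exists (induced (graph_of f) (basin f r)); first exact: imset_f.
by rewrite verts_induced.
Qed.

Lemma labeled_root k (X : {set T}) f x : optimal (arc_rel V) arc_cost k f -> x \in X -> f x = None ->
  labeled V v k X.
Proof.
move=> of_ xX fx; apply/exists_inP; exists (graph_of f); first exact: graph_of_min.
pose C := [set y in verts (graph_of f) | connect (adj_rel (graph_of f)) x y].
have CF : C \in comp_verts (graph_of f) by apply: imset_f; rewrite inE.
apply/exists_inP; exists (induced (graph_of f) C); first exact: imset_f.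
apply/exists_inP; exists x => //; rewrite /is_root verts_induced // !inE connect0 /=.
by apply/forallP=> y; rewrite !inE /= fx.
Qed.

End MinWeight.

(** * Assembly, with $k=j+1$ *)

Theorem theorem3 (R : realFieldType) (T : finType) (V : digraph T)
    (v : T -> T -> R)
    (V_verts : verts V = [set: T]) (V_loopless : loopless V)
    (V_spanning_tree : exists t : digraph T, is_tree V t && spanning V t)
    (k : nat) (k_ge1 : (1 <= k)%N) (k_le : (k <= #|T| - 1)%N)
    (phi_gap : (phi V v k - phi V v k.+1 < phi V v k.-1 - phi V v k)%E)
    (X : {set T}) (X_unlabeled : X \in unlabeled_atoms V v k) :
  [set out_restr X F | F in min_forests V v k.-1]
    \subset min_trees_leaving V v X.
Proof.
apply/subsetP=> _ /imsetP[F0 F0min ->].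
case: k k_ge1 k_le phi_gap X_unlabeled F0min => // j _ _ /= gap Xun F0min.
have [F0T out0 F00 o0 w0] := min_forests_optimal V_verts F0min.
have phiE i F : F \in min_forests V v i -> phi V v i = (weight v F)%:E.
  by rewrite inE => /andP[_ /eqP->].
rewrite (phiE _ _ F0min) in gap.
(* Were $\phi^k$ infinite, the larger side of the gap would be [-oo]. *)
have [F1 F1min] : exists F1, F1 \in min_forests V v j.+1.
  by apply: minimizers_ex; apply: contraTneq gap => e; rewrite -leNgt [phi V v j.+1]e leNye.
have [_ _ _ o1 w1] := min_forests_optimal V_verts F1min.
have real_gap f g h : optimal (arc_rel V) (arc_cost v) j.+1 f ->
    feasible (arc_rel V) j g -> feasible (arc_rel V) j.+2 h ->
  cost (arc_cost v) setT f + cost (arc_cost v) setT f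
    < cost (arc_cost v) setT g + cost (arc_cost v) setT h.
  move=> of_ fg fh; move: gap.
  rewrite (phiE _ _ (graph_of_min V_verts of_)) weight_graph_of w0.
  have := min_weight_le v (graph_of_forest V_verts fh); rewrite weight_graph_of.
  rewrite -/(phi V v j.+2).
  have := o0.2 _ fg.
  (* The value [+oo] contradicts the bound by the cost of [h], and [-oo] contradicts the gap. *)
  case: (phi V v j.+2) => [w||] //=; rewrite ?lee_fin ?lte_fin; lra.
have /setDP[Xat Xunl] := Xun.
have XA : X \in atoms (generated_algebra (tree_vertex_sets V v j.+1)) by [].
have X0 : X != set0 by move: XA; rewrite inE => /and3P[].
(* A forest on a nonempty vertex set has a root, so the existence of [F0] excludes $k=1$. *)
have j0 : (0 < j)%N.
  have [x _] := set0Pn _ X0; have [rf _ <-] := o0.1.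
  by have [r rr _] := rooted_basin x rf; apply/card_gt0P; exists r.
have rootless f : optimal (arc_rel V) (arc_cost v) j.+1 f -> {in X, forall x, f x <> None}.
  move=> of_ x xX fx; case/negP: Xunl; rewrite inE Xat /=.
  exact: labeled_root of_ xX fx.
have unsplit f r : optimal (arc_rel V) (arc_cost v) j.+1 f -> r \in root_set f ->
    {in X &, forall x y, (x \in basin f r) = (y \in basin f r)}.
  by move=> of_ fr; apply: (atom_unsplit XA); apply/tree_vertex_setsP => //; exists f, r.
have separated x y : x \in X -> y \notin X -> exists f r,
    [/\ optimal (arc_rel V) (arc_cost v) j.+1 f, r \in root_set f
      & (x \in basin f r) != (y \in basin f r)].
  move=> xX yX; have [B /(tree_vertex_setsP _ V_verts)[f [r [of_ fr ->]]] ne] := atom_separated XA xX yX.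
  by exists f, r.
have [lX uniq least] := optimal_leaving real_gap X0 rootless unsplit separated j0 o1 o0.
apply/minimizersP; split; first exact: out_restr_leaving.
move=> t /[dup] /tree_leaving[outt lt at_ nt] _.
rewrite weight_out_restr // weight_next // (cost_splitT _ X (next t)).
rewrite [X in _ <= _ + X]big1 ?addr0 => [|x]; first exact: least.
by rewrite inE => /nt; rewrite /arc_cost => ->.
Qed.
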